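(* Let $A$ be an associative algebra over an algebraically closed field $F$ of characteristic zero and let $L=[A,A]$. Let $I$ be a subspace of $L$. Then $I$ is a regular inner ideal of $L$ if and only if there exist a left ideal $\mathcal{L}$ and a right ideal $\mathcal{R}$ of $A$ such that $\mathcal{L}\mathcal{R}=0$ and $$\mathcal{R}\mathcal{L}\subseteq I\subseteq\mathcal{R}\cap\mathcal{L}\cap L.$$ In particular, if $A$ is von Neumann regular then every regular inner ideal of $L$ is of the form $I=\mathcal{R}\mathcal{L}=\mathcal{R}\cap\mathcal{L}$ for some left ideal $\mathcal{L}$ and right ideal $\mathcal{R}$ of $A$.
   Context: $[A,A]$ is the span of all $[a,b]=ab-ba$, $a,b\in A$, regarded as a Lie algebra. Products of subspaces denote spans of products. A subspace $I$ of $L=[A,A]$ with $I^2=0$ is called a regular inner ideal of $L$ (with respect to $A$) if $IAI\subseteq I$. $A$ is von Neumann regular if for every $x\in A$ there is $y\in A$ with $xyx=x$. Algebras need not have an identity. *)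

(* Defs.v *)
From HB Require Import structures.
From mathcomp Require Import all_boot all_order all_algebra.
From mathcomp Require Import classical_sets.

Set Implicit Arguments.
Unset Strict Implicit.
Unset Printing Implicit Defensive.

Import GRing.Theory.
Local Open Scope classical_set_scope.
Local Open Scope ring_scope.

(* Associative algebras without a unit: MathComp's algType is unital, so the
   product is that of the (multiplicative) semigroupType, written (x * y)%g. *)
HB.mixin Record SemigroupLmodule_isNUAlgebra (R : pzRingType) A
    of Semigroup A & GRing.Lmodule R A := {
  numulDl : left_distributive (fun x y : A => (x * y)%g) +%R;
  numulDr : right_distributive (fun x y : A => (x * y)%g) +%R;
  nuscalerAl : forall (a : R) (x y : A), a *: (x * y)%g = ((a *: x) * y)%g;
  nuscalerAr : forall (a : R) (x y : A), a *: (x * y)%g = (x * (a *: y))%g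
}.

#[short(type="nuAlgType")]
HB.structure Definition NUAlgebra (R : pzRingType) :=
  { A of SemigroupLmodule_isNUAlgebra R A & Semigroup A & GRing.Lmodule R A }.

Section NUAlgebraDefs.
Variables (F : fieldType) (A : nuAlgType F).
Implicit Types (X Y I : set A) (x y : A).

Definition is_subspace X : Prop := GRing.submod_closed [in X].

Definition lspan X : set A := smallest is_subspace X.

Definition prod_space X Y : set A := lspan [set (x * y)%g | x in X & y in Y].

Definition commutator x y : A := (x * y)%g - (y * x)%g.

Definition lie_space X Y : set A := lspan [set commutator x y | x in X & y in Y].

Definition is_left_ideal X : Prop :=
  is_subspace X /\ prod_space [set: A] X `<=` X.

Definition is_right_ideal X : Prop :=
  is_subspace X /\ prod_space X [set: A] `<=` X.

(* The condition [I, [I, L]] `<=` I making I an inner ideal of the Lie algebra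
   L = [A, A] is not required separately: when I^2 = 0 it follows from
   IAI `<=` I. *)
Definition regular_inner_ideal I : Prop :=
  [/\ is_subspace I, I `<=` lie_space [set: A] [set: A],
      prod_space I I = [set 0] &
      prod_space (prod_space I [set: A]) I `<=` I].

End NUAlgebraDefs.

Definition von_neumann_regular (F : fieldType) (A : nuAlgType F) : Prop :=
  forall x : A, exists y : A, (x * y * x)%g = x.

(* Main.v *)
Require Import Defs.
From mathcomp Require Import all_boot all_order all_algebra.
From mathcomp Require Import classical_sets.

(** Given a regular inner ideal I, take for LI and RI the one-sided ideals
    I + AI and I + IA that I generates.  Every product of their generators
    contains two factors from I: in LI RI these are adjacent, so the product
    vanishes because I^2 = 0; in RI LI they are adjacent or separated by an
    element of A, so the product lies in I because IAI is contained in I.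
    Conversely, if RI LI <= I <= RI and I <= LI, then I^2 <= LI RI = 0 and
    IAI <= RI (A LI) <= RI LI <= I.

    When A is von Neumann regular, each x in the intersection of RI and LI is
    x y x = x (y x), a product of an element of RI and one of LI, so the
    inclusions RI LI <= I <= RI `&` LI collapse to equalities. *)

Import GRing.Theory.

Local Open Scope classical_set_scope.
Local Open Scope ring_scope.

Section RegularInnerIdeals.
Variables (F : fieldType) (A : nuAlgType F).
Implicit Types (X Y Z I LI RI : set A) (x y a : A).

Lemma is_subspaceP X :
  is_subspace X <->
  X 0 /\ forall (c : F) x y, X x -> X y -> X (c *: x + y).
Proof.
split=> -[X0 XD]; split.
- exact: set_mem X0.
- by move=> c x y /mem_set Xx /mem_set Xy; apply: set_mem; apply: XD.
- exact: mem_set.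
- by move=> c x y /set_mem Xx /set_mem Xy; apply: mem_set; apply: XD.
Qed.

Lemma lspan_subspace X : is_subspace (lspan X).
Proof.
apply/is_subspaceP; split=> [Y [/is_subspaceP[Y0 _] _]//|c x y Xx Xy Y [sY XY]].
by have /is_subspaceP[_ YD] := sY; apply: YD; [apply: Xx|apply: Xy].
Qed.

Lemma lspan0 X : lspan X 0.
Proof. by have /is_subspaceP[] := lspan_subspace X. Qed.

Lemma sub_lspan X : X `<=` lspan X.
Proof. by move=> x Xx Y [_]; apply. Qed.

Lemma lspan_min X Y : is_subspace Y -> X `<=` Y -> lspan X `<=` Y.
Proof. by move=> sY XY x; apply. Qed.

Lemma subspace_set0 : is_subspace ([set 0] : set A).
Proof.
by apply/is_subspaceP; split=> //= c x y -> ->; rewrite scaler0 addr0.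
Qed.

Lemma numul0r y : (0 * y)%g = 0 :> A.
Proof. by rewrite -(scale0r 0) -nuscalerAl !scale0r. Qed.

Lemma numulr0 x : (x * 0)%g = 0 :> A.
Proof. by rewrite -(scale0r 0) -nuscalerAr !scale0r. Qed.

Lemma subspace_preimage_mull y Z :
  is_subspace Z -> is_subspace [set x | Z (x * y)%g].
Proof.
move=> /is_subspaceP[Z0 ZD]; apply/is_subspaceP; split=> /= [|c u v Zu Zv].
  by rewrite numul0r.
by rewrite numulDl -nuscalerAl; apply: ZD.
Qed.

Lemma subspace_preimage_mulr x Z :
  is_subspace Z -> is_subspace [set y | Z (x * y)%g].
Proof.
move=> /is_subspaceP[Z0 ZD]; apply/is_subspaceP; split=> /= [|c u v Zu Zv].
  by rewrite numulr0.
by rewrite numulDr -nuscalerAr; apply: ZD.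
Qed.

Lemma mem_prod_space X Y x y : X x -> Y y -> prod_space X Y (x * y)%g.
Proof. by move=> Xx Yy; apply: sub_lspan; exists x => //; exists y. Qed.

Lemma prod_space_sub X Y Z : is_subspace Z ->
  (forall x y, X x -> Y y -> Z (x * y)%g) -> prod_space X Y `<=` Z.
Proof. by move=> sZ XYZ; apply: lspan_min => // _ [x Xx [y Yy <-]]; apply: XYZ. Qed.

Lemma prod_space_eq0 X Y :
  (forall x y, X x -> Y y -> (x * y)%g = 0) -> prod_space X Y = [set 0].
Proof.
move=> XY0; apply/seteqP; split; first exact: prod_space_sub subspace_set0 XY0.
by move=> _ ->; apply: lspan0.
Qed.

Lemma prod_space_eq0P X Y x y :
  prod_space X Y = [set 0] -> X x -> Y y -> (x * y)%g = 0.
Proof.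
by move=> XY0 Xx Yy; have := mem_prod_space _ _ _ _ Xx Yy; rewrite XY0.
Qed.

(** Bilinearity of the product: it is enough to multiply generators, since
    fixing one factor makes the condition on the other one linear. *)
Lemma lspan_mul X Y Z : is_subspace Z ->
  (forall x y, X x -> Y y -> Z (x * y)%g) ->
  forall x y, lspan X x -> lspan Y y -> Z (x * y)%g.
Proof.
move=> sZ XYZ x y Xx Yy.
apply: (lspan_min _ _ (subspace_preimage_mull y Z sZ) _ x Xx) => u Xu.
apply: (lspan_min _ _ (subspace_preimage_mulr u Z sZ) _ y Yy) => v Yv.
exact: XYZ.
Qed.

Lemma left_ideal_mul LI a x : is_left_ideal LI -> LI x -> LI (a * x)%g.
Proof. by case=> _ sub LIx; apply: sub; apply: mem_prod_space. Qed.

(** As A need not have an identity, X need not lie in AX and has to be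
    added to it. *)
Definition left_ideal_gen X : set A :=
  lspan (X `|` [set (a * x)%g | a in [set: A] & x in X]).

Definition right_ideal_gen X : set A :=
  lspan (X `|` [set (x * a)%g | x in X & a in [set: A]]).

Lemma sub_left_ideal_gen X : X `<=` left_ideal_gen X.
Proof. by move=> x Xx; apply: sub_lspan; left. Qed.

Lemma sub_right_ideal_gen X : X `<=` right_ideal_gen X.
Proof. by move=> x Xx; apply: sub_lspan; left. Qed.

Lemma left_ideal_genP X : is_left_ideal (left_ideal_gen X).
Proof.
have sX : is_subspace (left_ideal_gen X) by exact: lspan_subspace.
split=> //; apply: prod_space_sub => // a y _ Xy.
apply: (lspan_min _ _ (subspace_preimage_mulr a _ sX) _ y Xy) => {Xy}.
move=> z [Xz|[b _ [x Xx <-]]]; apply: sub_lspan; right.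
- by exists a => //; exists z.
- by exists (a * b)%g => //; exists x; rewrite // mulgA.
Qed.

Lemma right_ideal_genP X : is_right_ideal (right_ideal_gen X).
Proof.
have sX : is_subspace (right_ideal_gen X) by exact: lspan_subspace.
split=> //; apply: prod_space_sub => // y a Xy _.
apply: (lspan_min _ _ (subspace_preimage_mull a _ sX) _ y Xy) => {Xy}.
move=> z [Xz|[x Xx [b _ <-]]]; apply: sub_lspan; right.
- by exists z => //; exists a.
- by exists x => //; exists (b * a)%g; rewrite // mulgA.
Qed.

Lemma left_right_ideal_gen_eq0 I :
  prod_space I I = [set 0] ->
  prod_space (left_ideal_gen I) (right_ideal_gen I) = [set 0].
Proof.
move=> II0; apply: prod_space_eq0.
apply: (lspan_mul _ _ [set 0]); first exact: subspace_set0.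
have mulI0 x y : I x -> I y -> (x * y)%g = 0.
  exact: prod_space_eq0P II0.
move=> u v [Iu|[a _ [x Ix <-]]] [Iv|[y Iy [b _ <-]]] /=.
- exact: mulI0.
- by rewrite mulgA (mulI0 u y) // numul0r.
- by rewrite -mulgA (mulI0 x v) // numulr0.
- by rewrite -mulgA (mulgA x) (mulI0 x y) // numul0r numulr0.
Qed.

Lemma right_left_ideal_gen_sub I : regular_inner_ideal I ->
  prod_space (right_ideal_gen I) (left_ideal_gen I) `<=` I.
Proof.
move=> [sI _ II0 IAI]; apply: prod_space_sub => //; apply: (lspan_mul _ _ I) => //.
have I0 : I 0 by case/is_subspaceP: sI.
have mulIAI x a y : I x -> I y -> I (x * a * y)%g.
  by move=> Ix Iy; apply: IAI; apply: mem_prod_space => //; apply: mem_prod_space.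
move=> u v [Iu|[x Ix [a _ <-]]] [Iv|[b _ [y Iy <-]]].
- by rewrite (prod_space_eq0P _ _ _ _ II0).
- by rewrite mulgA; apply: mulIAI.
- exact: mulIAI.
- by rewrite mulgA -(mulgA x); apply: mulIAI.
Qed.

Lemma regular_inner_ideal_one_sided I : regular_inner_ideal I ->
  exists LI RI : set A,
    [/\ is_left_ideal LI, is_right_ideal RI,
        prod_space LI RI = [set 0],
        prod_space RI LI `<=` I &
        I `<=` RI `&` LI `&` lie_space [set: A] [set: A]].
Proof.
move=> regI; have [_ IL II0 _] := regI.
exists (left_ideal_gen I), (right_ideal_gen I); split.
- exact: left_ideal_genP.
- exact: right_ideal_genP.
- exact: left_right_ideal_gen_eq0.
- exact: right_left_ideal_gen_sub.
- move=> x Ix; split; last exact: IL.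
  by split; [exact: sub_right_ideal_gen|exact: sub_left_ideal_gen].
Qed.

Lemma one_sided_regular_inner_ideal I LI RI : is_subspace I ->
  I `<=` lie_space [set: A] [set: A] -> is_left_ideal LI ->
  prod_space LI RI = [set 0] -> prod_space RI LI `<=` I ->
  I `<=` RI `&` LI -> regular_inner_ideal I.
Proof.
move=> sI IL lLI LR0 RLI IRL; split=> //.
  apply: prod_space_eq0 => x y /IRL[_ LIx] /IRL[RIy _].
  exact: prod_space_eq0P LR0 LIx RIy.
apply: prod_space_sub => // z y Pz Iy.
apply: (lspan_min _ _ (subspace_preimage_mull y I sI) _ z Pz) => {z Pz}.
move=> _ [x Ix [a _ <-]]; rewrite /= -mulgA; apply: RLI.
have [[RIx _] [_ LIy]] := (IRL _ Ix, IRL _ Iy).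
by apply: mem_prod_space => //; apply: left_ideal_mul.
Qed.

Lemma von_neumann_regular_cap_sub LI RI : von_neumann_regular A ->
  is_left_ideal LI -> RI `&` LI `<=` prod_space RI LI.
Proof.
move=> vnA lLI x [RIx LIx]; have [y <-] := vnA x.
by rewrite -mulgA; apply: mem_prod_space => //; apply: left_ideal_mul.
Qed.

End RegularInnerIdeals.

Theorem proposition4p9 (F : closedFieldType) (charF0 : [pchar F] =i pred0)
    (A : nuAlgType F) :
  let L := lie_space [set: A] [set: A] in
  (forall I : set A, is_subspace I -> I `<=` L ->
    (regular_inner_ideal I <->
     exists LI RI : set A,
       [/\ is_left_ideal LI, is_right_ideal RI,
           prod_space LI RI = [set 0],
           prod_space RI LI `<=` I &
           I `<=` RI `&` LI `&` L]))
  /\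
  (von_neumann_regular A ->
   forall I : set A, regular_inner_ideal I ->
     exists LI RI : set A,
       [/\ is_left_ideal LI, is_right_ideal RI,
           I = prod_space RI LI & prod_space RI LI = RI `&` LI]).
Proof.
move=> L; split=> [I sI IL|vnA I regI].
  split=> [|[LI [RI [lLI _ LR0 RLI IRLL]]]].
    exact: regular_inner_ideal_one_sided.
  apply: (one_sided_regular_inner_ideal _ _ I LI RI) => //.
  by move=> x /IRLL[].
have [LI [RI [lLI rRI _ RLI IRLL]]] := regular_inner_ideal_one_sided _ _ _ regI.
have IRL : I `<=` RI `&` LI by move=> x /IRLL[].
have capRL := von_neumann_regular_cap_sub _ _ _ _ vnA lLI.
exists LI, RI; split=> //; apply/seteqP; split=> //.
- by move=> x /IRL /capRL.
- by move=> x /RLI /IRL.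
Qed.
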